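(* Let $r\in\mathbb{N}=\{1,2,\dots\}$ and let $G=\mathcal{AT}((r^{k-1})_{k\ge1})$ be the infinite antitree with generations $V_k$, $|V_k|=r^{k-1}$. Then the Ollivier-Ricci curvature with idleness $0$ of edges of $G$ is $$\kappa_0(x,y)=\begin{cases}\dfrac{r-1}{r(r+1)} & \text{for } x\in V_1,\ y\in V_2,\\[2mm] \dfrac{(r-1)^2(r+1)r^{k-2}}{(r^k+r^{k-1}+r^{k-2}-1)(r^{k+1}+r^k+r^{k-1}-1)} & \text{for } x\in V_k,\ y\in V_{k+1},\ k\ge2,\\[2mm] 1-\dfrac{1}{r^k+r^{k-1}+r^{k-2}-1} & \text{for } x,y\in V_k,\ x\ne y,\ k\ge2.\end{cases}$$ In particular, $\kappa_0$ of radial edges decays asymptotically like $\frac{1}{r^k}$ as $k\to\infty$.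
   Context: Antitree: for a sequence $(a_k)_{k\ge1}$ of positive integers, $\mathcal{AT}((a_k))$ is the simple graph whose vertex set is the disjoint union $V=\bigsqcup_{k\ge1}V_k$ of ''generations'' with $|V_k|=a_k$, where two distinct vertices $x\in V_k$, $y\in V_l$ are adjacent if and only if $|k-l|\le 1$ (so each generation induces a complete graph, consecutive generations are completely joined, and there are no other edges). Radial edges are the edges between vertices of different generations, i.e. between some $x\in V_k$ and $y\in V_{k+1}$. Ollivier-Ricci curvature: let $d$ be the combinatorial distance and $d_x$ the degree of $x$. For $x\in V$ and $p\in[0,1]$ let $\mu_x^p$ be the probability measure on $V$ with $\mu_x^p(x)=p$, $\mu_x^p(z)=\frac{1-p}{d_x}$ for $z\sim x$ (that is, $z$ adjacent to $x$), and $\mu_x^p(z)=0$ otherwise. The Wasserstein distance of two probability measures $\mu_1,\mu_2$ on $V$ is $W_1(\mu_1,\mu_2)=\inf_\pi\sum_{x,y\in V}d(x,y)\pi(x,y)$, the infimum running over all $\pi:V\times V\to[0,1]$ with $\mu_1(x)=\sum_y\pi(x,y)$ and $\mu_2(y)=\sum_x\pi(x,y)$. For an edge $x\sim y$, $\kappa_p(x,y)=1-W_1(\mu_x^p,\mu_y^p)$, where $p$ is called the idleness; here $p=0$.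
   Formalization: The asymptotic claim is read as: r^k times the curvature of radial edges tends to a constant C, with C > 0 asserted only for r ≥ 2; for r = 1 all radial curvatures are 0, so they do not behave like 1/r^k = 1. The curvature formulas are stated for all r ≥ 1. *)

(* Defs.v *)
From mathcomp Require Import all_boot all_order all_algebra finmap.
From mathcomp Require Import all_classical all_reals all_analysis.

Set Implicit Arguments.
Unset Strict Implicit.
Unset Printing Implicit Defensive.

Import Order.TTheory GRing.Theory Num.Theory.
Import numFieldNormedType.Exports.

Local Open Scope classical_set_scope.
Local Open Scope ring_scope.

Definition neighbors (V : choiceType) (e : rel V) (x : V) : set V :=
  [set z | e x z].

(* [fset_set] is the empty set on infinite sets, so this is meaningful for
   locally finite graphs only. *)
Definition degree (V : choiceType) (e : rel V) (x : V) : nat :=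
  #|` fset_set (neighbors e x)|.

(* Least length of a walk from x to y; it is +oo if there is none. *)
Definition dist (R : realType) (V : choiceType) (e : rel V) (x y : V) : \bar R :=
  ereal_inf [set (size p)%:R%:E | p in [set p : seq V | path e x p /\ last x p = y]].

Definition walk_measure (R : realType) (V : choiceType) (e : rel V)
    (p : R) (x z : V) : R :=
  if z == x then p else if e x z then (1 - p) / (degree e x)%:R else 0.

Definition coupling (R : realType) (V : choiceType) (mu1 mu2 : V -> R)
    (pi : V -> V -> R) : Prop :=
  [/\ forall x y, 0 <= pi x y <= 1,
      forall x, (\esum_(y in [set: V]) (pi x y)%:E = (mu1 x)%:E)%E
    & forall y, (\esum_(x in [set: V]) (pi x y)%:E = (mu2 y)%:E)%E].

Definition wasserstein1 (R : realType) (V : choiceType) (e : rel V)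
    (mu1 mu2 : V -> R) : \bar R :=
  ereal_inf [set (\esum_(z in [set: V * V]) (dist R e z.1 z.2 * (pi z.1 z.2)%:E))%E
            | pi in [set pi | coupling mu1 mu2 pi]].

Definition ollivier_ricci (R : realType) (V : choiceType) (e : rel V)
    (p : R) (x y : V) : \bar R :=
  (1 - wasserstein1 e (walk_measure e p x) (walk_measure e p y))%E.

(* Generations are numbered from 1: the vertex [Tagged _ i] with tag [k] and
   [i : 'I_(a k.+1)] lies in generation [k.+1], and [a 0] is never used. *)
Definition antitree (a : nat -> nat) : choiceType := {k : nat & 'I_(a k.+1)}.

Definition gen (a : nat -> nat) (x : antitree a) : nat := (tag x).+1.

Definition generation (a : nat -> nat) (k : nat) : set (antitree a) :=
  [set x | gen x = k].

Definition antitree_adj (a : nat -> nat) : rel (antitree a) :=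
  fun x y => (x != y) && (`|(gen x)%:Z - (gen y)%:Z| <= 1).

Lemma antitree_adj_sym (a : nat -> nat) : symmetric (@antitree_adj a).
Proof. by move=> x y; rewrite /antitree_adj eq_sym distrC. Qed.

Lemma antitree_adj_irr (a : nat -> nat) : irreflexive (@antitree_adj a).
Proof. by move=> x; rewrite /antitree_adj eqxx. Qed.

(* Main.v *)
Require Import Defs.
From mathcomp Require Import all_boot all_order all_algebra finmap.
From mathcomp Require Import all_classical all_reals all_analysis.
From mathcomp Require Import lra zify ring.

Set Implicit Arguments.
Unset Strict Implicit.
Unset Printing Implicit Defensive.

Import Order.TTheory GRing.Theory Num.Theory.
Import numFieldNormedType.Exports.

Local Open Scope classical_set_scope.
Local Open Scope ring_scope.

(** Why the formulas hold.  By Kantorovich duality, if [f] grows by at most 1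
    along edges, then every coupling of [mu] and [nu] costs at least
    [sum f nu - sum f mu], with equality as soon as the coupling only uses
    pairs [(u, v)] with [d(u, v) = f v - f u] ([wasserstein1E]).  So each
    curvature follows from a potential [f], a transport plan that is tight for
    it, and the mean values of [f] under the two random walks.

    - Same generation: [x] and [y] have the same neighbours except each other,
      so the mass [1 / d] is moved from [y] to [x], and [f] is the indicator of
      [x] ([curvature_spherical]).
    - Root edge: all the mass of [x] is in generation 2, and whatever exceeds
      the common part moves to the neighbouring generations 1 and 3; [f] is the
      distance of the generation to 2 ([curvature_root]).
    - Other radial edges: [f] is the generation, so a plan is tight when all
      mass that moves goes to a strictly later generation.  The measure of [y]
      exceeds that of [x] only at [x] and in generation [k + 2].  The vertex
      [x] is filled from generation [k - 1]; the rest of the excess, which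
      lies in generations [k - 1] to [k + 1], goes to generation [k + 2] in any
      way.  This is possible because [d_x <= d_y], that is [a_{k-1} <= a_{k+2}].
      Hence the curvature is the loss of radial drift
      [(a_{k+1} - a_{k-1}) / d_x - (a_{k+2} - a_k) / d_y]
      ([curvature_radial]).

    Plans are never written down: they are assembled from the identity plan and
    product plans ([transportable_diag], [transportable_prod],
    [transportableD]), and moving the excess of one measure over another of
    equal mass along a product plan is [transportable_excess].

    For [a_k = r^(k-1)] the drift formula becomes the stated rational function
    of [q = r].  After multiplication by [q ^ k] it is a continuous function of
    [q ^ (-k)] ([geometric_radial_rescaled]), whose value at 0 is the limit
    [(q - 1)^2 (q + 1) q / (q^2 + q + 1)^2]. *)

(** * Nonnegative functions of finite total mass *)

Section Mass.
Variables (R : realType) (V : choiceType).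
Implicit Types (F G : V -> R) (m : R).

Lemma esumZ (I : choiceType) (D : set I) (c : R) (h : I -> \bar R) : 0 <= c ->
  (forall i, 0 <= h i)%E ->
  (\esum_(i in D) (c%:E * h i) = c%:E * \esum_(i in D) h i)%E.
Proof.
have le_esumZ (b : R) (k : I -> \bar R) : 0 <= b -> (forall i, 0 <= k i)%E ->
    (\esum_(i in D) (b%:E * k i) <= b%:E * \esum_(i in D) k i)%E.
  move=> b0 k0; apply: ge_ereal_sup => _ [X [finX XD] <-].
  rewrite -ge0_mule_fsumr//; apply: lee_wpmul2l; first by rewrite lee_fin.
  by apply: esum_ge; exists X.
move=> c0 h0; apply/eqP; rewrite eq_le le_esumZ//=.
have [c_gt0|c_le0|<-] := ltgtP 0 c; last 2 first.
- by move: c_le0; rewrite ltNge c0.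
- by rewrite mul0e; apply: esum_ge0 => i _; rewrite mul0e.
have cV (x : \bar R) : (c^-1%:E * (c%:E * x) = x)%E.
  by rewrite muleA -EFinM mulVf ?mul1e// gt_eqF.
have ch0 i : (0 <= c%:E * h i)%E by rewrite mule_ge0// lee_fin ltW.
rewrite -[leRHS]mul1e -(mulfV (lt0r_neq0 c_gt0)) EFinM -muleA.
apply: lee_wpmul2l; first by rewrite lee_fin ltW.
under eq_esum do rewrite -(cV (h _)).
by apply: le_esumZ => //; rewrite invr_ge0 ltW.
Qed.

Definition has_mass F m :=
  (forall z, 0 <= F z) /\ (\esum_(z in [set: V]) (F z)%:E = m%:E)%E.

Lemma eq_has_mass F G m : F =1 G -> has_mass F m -> has_mass G m.
Proof. by move=> /funext ->. Qed.

Lemma has_massD F G m m' :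
  has_mass F m -> has_mass G m' -> has_mass (fun z => F z + G z) (m + m').
Proof.
move=> [F0 Fm] [G0 Gm]; split=> [z|]; first exact: addr_ge0.
under eq_esum do rewrite EFinD.
by rewrite esumD ?Fm ?Gm// => z _; rewrite lee_fin.
Qed.

Lemma has_massZ F m c : 0 <= c -> has_mass F m ->
  has_mass (fun z => c * F z) (c * m).
Proof.
move=> c0 [F0 Fm]; split=> [z|]; first exact: mulr_ge0.
under eq_esum do rewrite EFinM.
by rewrite esumZ ?Fm// => z; rewrite lee_fin.
Qed.

Lemma has_massB F G m m' : (forall z, G z <= F z) ->
  has_mass F m -> has_mass G m' -> has_mass (fun z => F z - G z) (m - m').
Proof.
move=> GF [F0 Fm] [G0 Gm]; split=> [z|]; first by rewrite subr_ge0.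
have : (\esum_(z in [set: V]) (F z - G z)%:E + m'%:E = m%:E)%E.
  rewrite -Gm -Fm -esumD; last 2 first.
  - by move=> z _; rewrite lee_fin subr_ge0.
  - by move=> z _; rewrite lee_fin.
  by apply: eq_esum => z _; rewrite -EFinD subrK.
move=> /(congr1 (fun x => x - m'%:E)%E).
by rewrite addeK// -EFinB.
Qed.

Lemma has_mass_le F G m : (forall z, 0 <= G z) -> (forall z, G z <= F z) ->
  has_mass F m -> exists m', has_mass G m'.
Proof.
move=> G0 GF [F0 Fm].
have Gle : (\esum_(z in [set: V]) (G z)%:E <= m%:E)%E.
  by rewrite -Fm; apply: le_esum => z _; rewrite lee_fin.
exists (fine (\esum_(z in [set: V]) (G z)%:E)); split=> //.
rewrite fineK// fin_numE gt_eqF/=; last first.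
  by rewrite (lt_le_trans (ltNyr 0))//; apply: esum_ge0 => z _; rewrite lee_fin.
by rewrite lt_eqF// (le_lt_trans Gle) ?ltry.
Qed.

Lemma has_mass_pt F m z : has_mass F m -> F z <= m.
Proof.
move=> [F0 Fm]; rewrite -lee_fin -Fm; apply: esum_ge.
by exists [set z]; [split => //|rewrite fsbig_set1].
Qed.

Lemma has_mass_eq0 F z : has_mass F 0 -> F z = 0.
Proof.
by move=> F0; apply/eqP; rewrite eq_le (has_mass_pt z F0); case: F0 => ->.
Qed.

Lemma has_mass0 : has_mass (fun=> 0) 0.
Proof. by split=> //; apply: esum1. Qed.

Lemma has_mass_delta x : has_mass (fun z => (z == x)%:R) 1.
Proof.
split=> //.
rewrite -[RHS](@esum_set1 _ _ x (fun=> 1%E))//.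
rewrite [RHS]esum_mkcond; apply: eq_esum => z _.
by rewrite in_set1; case: (z == x).
Qed.

Lemma has_mass_set (A : set V) : finite_set A ->
  has_mass (fun z => (z \in A)%:R) (#|` fset_set A|)%:R.
Proof.
move=> finA; split=> //.
transitivity (\esum_(z in A) (1 : \bar R))%E.
  by rewrite [RHS]esum_mkcond; apply: eq_esum => z _; case: (z \in A).
rewrite esum_fset// fsbig_finite//= -[in RHS]sum1_size.
by rewrite natr_sum -sumEFin.
Qed.

End Mass.

(** * Transport plans with prescribed support *)

Section Transport.
Variables (R : realType) (V : choiceType).
Implicit Types (mu nu : V -> R) (S : V -> V -> Prop).

(** Marginals are required of arbitrary nonnegative [mu], [nu], without bound on
    the plan, so that plans can be added up. *)
Definition transportable S mu nu := exists2 pi : V -> V -> R,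
  (forall u v, 0 <= pi u v) /\ (forall u v, pi u v != 0 -> S u v) &
  (forall u, has_mass (pi u) (mu u)) /\ (forall v, has_mass (pi^~ v) (nu v)).

Lemma transportable_diag S mu : (forall z, 0 <= mu z) -> (forall z, S z z) ->
  transportable S mu mu.
Proof.
move=> mu0 Srefl; exists (fun u v => mu u * (v == u)%:R).
  split=> [u v|u v]; first by rewrite mulr_ge0.
  by have [->|] := eqVneq v u; rewrite ?mulr0 ?eqxx.
split=> [u|v].
  rewrite -[X in has_mass _ X]mulr1; apply: has_massZ => //.
  exact: has_mass_delta.
rewrite -[X in has_mass _ X]mulr1.
apply: (@eq_has_mass _ _ (fun u => mu v * (u == v)%:R)) => [u|].
  by rewrite [v == u]eq_sym; have [->|] := eqVneq u v; rewrite ?mulr0.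
by apply: has_massZ => //; exact: has_mass_delta.
Qed.

(** The plan is the product [mu u * nu v / m]; for [m = 0] both measures vanish,
    and the value [0^-1 = 0] still gives a valid plan. *)
Lemma transportable_prod S mu nu m : has_mass mu m -> has_mass nu m ->
  (forall u v, mu u != 0 -> nu v != 0 -> S u v) -> transportable S mu nu.
Proof.
move=> mum num Smn; have m0 : 0 <= m.
  rewrite -lee_fin -(proj2 mum); apply: esum_ge0 => z _.
  by rewrite lee_fin (proj1 mum).
exists (fun u v => m^-1 * mu u * nu v).
  split=> u v; first by rewrite !mulr_ge0 ?invr_ge0 ?(proj1 mum) ?(proj1 num).
  by rewrite !mulf_eq0 !negb_or -andbA => /and3P[_]; apply: Smn.
have [mE|m_neq0] := eqVneq m 0.
  rewrite mE in mum num *.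
  split=> [u|v]; rewrite (has_mass_eq0 _ mum, has_mass_eq0 _ num).
    by apply: eq_has_mass (@has_mass0 R V) => v; rewrite mulr0 mul0r.
  by apply: eq_has_mass (@has_mass0 R V) => u; rewrite mulr0.
have mVK w : m^-1 * w * m = w by rewrite mulrAC mulVf ?mul1r.
split=> [u|v]; rewrite -[X in has_mass _ X]mVK.
  by apply: has_massZ => //; rewrite mulr_ge0 ?invr_ge0 ?(proj1 mum).
apply: (@eq_has_mass _ _ (fun u => m^-1 * nu v * mu u)) => [u|].
  by rewrite mulrAC.
by apply: has_massZ => //; rewrite mulr_ge0 ?invr_ge0 ?(proj1 num).
Qed.

Lemma transportableD S mu nu mu' nu' :
  transportable S mu nu -> transportable S mu' nu' ->
  transportable S (fun z => mu z + mu' z) (fun z => nu z + nu' z).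
Proof.
move=> [p [p0 Sp] [pmu pnu]] [p' [p'0 Sp'] [p'mu p'nu]].
exists (fun u v => p u v + p' u v).
  split=> u v; first exact: addr_ge0.
  have [->|/Sp//] := eqVneq (p u v) 0; rewrite add0r; exact: Sp'.
by split=> z; exact: has_massD.
Qed.

(** Leave the common part [min(mu, nu)] in place; what remains of [mu] and of
    [nu] has equal mass, so a product plan carries one onto the other.  It is
    supported where both remainders are positive. *)
Lemma transportable_excess S mu nu m : has_mass mu m -> has_mass nu m ->
  (forall z, S z z) -> (forall u v, nu u < mu u -> mu v < nu v -> S u v) ->
  transportable S mu nu.
Proof.
move=> mum num Srefl Sexc; pose c z := Num.min (mu z) (nu z).
have c0 z : 0 <= c z by rewrite le_min (proj1 mum) (proj1 num).
have cmu z : c z <= mu z by rewrite ge_min lexx.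
have cnu z : c z <= nu z by rewrite ge_min lexx orbT.
have [m' cm'] := has_mass_le c0 cmu mum.
rewrite (_ : mu = fun z => c z + (mu z - c z)); last first.
  by apply/funext => z; rewrite addrC subrK.
rewrite (_ : nu = fun z => c z + (nu z - c z)); last first.
  by apply/funext => z; rewrite addrC subrK.
apply: transportableD; first exact: transportable_diag.
apply: transportable_prod (has_massB cmu mum cm') (has_massB cnu num cm') _.
move=> u v; rewrite /c.
have [|mn _] := leP (mu u) (nu u); first by rewrite subrr eqxx.
have [nm|] := leP (nu v) (mu v); last by move=> ? ?; apply: Sexc.
by rewrite subrr eqxx.
Qed.

End Transport.

(** * Kantorovich duality and complementary slackness *)

Section Duality.
Variables (R : realType) (V : choiceType) (e : rel V).
Implicit Types (f : V -> R).
Local Open Scope ereal_scope.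

Lemma dist_ge0 x y : 0 <= dist R e x y.
Proof. by apply: le_ereal_inf_tmp => _ [p _ <-]; rewrite lee_fin. Qed.

Lemma dist_le_path x p : path e x p -> dist R e x (last x p) <= (size p)%:R%:E.
Proof. by move=> ep; apply: ereal_inf_lbound; exists p. Qed.

Lemma dist_refl x : dist R e x x = 0.
Proof.
by apply/eqP; rewrite eq_le dist_ge0 andbT; have := @dist_le_path x [::] isT.
Qed.

Lemma dist_adj x y : e x y -> dist R e x y <= 1.
Proof. by move=> exy; apply: (@dist_le_path x [:: y]); rewrite /= exy. Qed.

(** Along a walk of length [n] the potential grows by at most [n]; when there is
    no walk the distance is infinite. *)
Lemma lipschitz_dist f : (forall u v, e u v -> f v <= f u + 1)%R ->
  forall x y, (f y)%:E <= dist R e x y + (f x)%:E.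
Proof.
move=> flip x y; rewrite -leeBlDr//.
apply: le_ereal_inf_tmp => _ [p [ep <-] <-].
rewrite -EFinB lee_fin lerBlDr.
elim: p x ep {y} => [|z p IHp] x /=; first by rewrite add0r.
move=> /andP[/flip exz /IHp]; move/le_trans; apply.
by rewrite -[(size p).+1%:R]natr1 -addrA lerD2l [(1 + _)%R]addrC.
Qed.

(** The pairs at which the Lipschitz bound on [f] is attained; the subtraction
    is avoided because the distance may be infinite. *)
Definition tight f (u v : V) : Prop := dist R e u v + (f u)%:E <= (f v)%:E.

Let cost (pi : V -> V -> R) : \bar R :=
  \esum_(z in [set: V * V]) (dist R e z.1 z.2 * (pi z.1 z.2)%:E).

Lemma esum_fst f mu (pi : V -> V -> R) : (forall z, 0 <= f z)%R ->
  (forall u v, 0 <= pi u v)%R ->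
  (forall u, \esum_(v in [set: V]) (pi u v)%:E = (mu u)%:E) ->
  \esum_(z in [set: V * V]) (f z.1 * pi z.1 z.2)%:E
  = \esum_(u in [set: V]) (f u * mu u)%:E.
Proof.
move=> f0 pi0 pimu; rewrite -setXTT.
rewrite -(esum_esum (J := fun=> setT) (a := fun u v => (f u * pi u v)%:E));
  last first.
  by move=> u v _ _; rewrite lee_fin mulr_ge0.
apply: eq_esum => u _; rewrite EFinM -pimu -esumZ//.
by move=> v; rewrite lee_fin.
Qed.

Lemma esum_snd f nu (pi : V -> V -> R) : (forall z, 0 <= f z)%R ->
  (forall u v, 0 <= pi u v)%R ->
  (forall v, \esum_(u in [set: V]) (pi u v)%:E = (nu v)%:E) ->
  \esum_(z in [set: V * V]) (f z.2 * pi z.1 z.2)%:E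
  = \esum_(v in [set: V]) (f v * nu v)%:E.
Proof.
move=> f0 pi0 pinu.
rewrite -(esum_fst (pi := fun v u => pi u v) f0 _ pinu)//.
have swap_bij : set_bij [set: V * V] [set: V * V] (fun z => (z.2, z.1)).
  split=> // [[u v] [u' v'] _ _ [-> ->]//|[u v] _].
  by exists (v, u).
by rewrite (reindex_esum _ _ _ _ swap_bij).
Qed.

(** Summing [d(u, v) + f u >= f v] against a coupling gives
    [cost + sum f mu >= sum f nu], with equality for a tight coupling.  The
    potential is nonnegative so that all the sums are sums of nonnegative terms
    and can be rearranged freely. *)
Lemma wasserstein1E f mu nu (a b : R) :
  (forall z, 0 <= f z)%R -> (forall u v, e u v -> f v <= f u + 1)%R ->
  (forall z, mu z <= 1)%R -> transportable (tight f) mu nu ->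
  has_mass (fun z => f z * mu z)%R a -> has_mass (fun z => f z * nu z)%R b ->
  wasserstein1 e mu nu = (b - a)%:E.
Proof.
move=> f0 flip mu1 [p [p0 ptight] [pmu pnu]] [_ fmua] [_ fnub].
have costD (pi : V -> V -> R) : (forall u v, 0 <= pi u v)%R ->
    (forall u, \esum_(v in [set: V]) (pi u v)%:E = (mu u)%:E) ->
    \esum_(z in [set: V * V])
      ((dist R e z.1 z.2 + (f z.1)%:E) * (pi z.1 z.2)%:E)
    = cost pi + a%:E.
  move=> pi0 pimu; rewrite -fmua -(esum_fst f0 pi0 pimu) -esumD; last 2 first.
  - by move=> z _; rewrite mule_ge0 ?lee_fin ?dist_ge0.
  - by move=> z _; rewrite lee_fin mulr_ge0.
  apply: eq_esum => z _; rewrite EFinM ge0_muleDl// ?dist_ge0// lee_fin//.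
apply/eqP; rewrite eq_le; apply/andP; split.
  apply: (@le_trans _ _ (cost p)).
    apply: ereal_inf_lbound; exists p => //; split=> [u v|u|v].
    - by rewrite p0 (le_trans (has_mass_pt v (pmu u))).
    - exact: (proj2 (pmu u)).
    - exact: (proj2 (pnu v)).
  rewrite EFinB leeBrDr// -(costD _ p0 (fun u => proj2 (pmu u))).
  rewrite -fnub -(esum_snd f0 p0 (fun v => proj2 (pnu v))).
  apply: le_esum => -[u v] _ /=.
  have [->|/ptight] := eqVneq (p u v) 0%R; first by rewrite mule0 mulr0.
  by move=> ?; rewrite EFinM lee_wpmul2r// lee_fin.
apply: le_ereal_inf_tmp => _ [pi [pi01 pimu pinu] <-].
have pi0 u v : (0 <= pi u v)%R by have /andP[] := pi01 u v.
rewrite EFinB leeBlDr// -/(cost pi) -(costD _ pi0 pimu).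
rewrite -fnub -(esum_snd f0 pi0 pinu); apply: le_esum => -[u v] _ /=.
by rewrite EFinM lee_wpmul2r ?lee_fin// lipschitz_dist.
Qed.

End Duality.

(** * Degrees, walk measures and distances in an antitree *)

Section Antitree.
Variables (R : realType) (a : nat -> nat).
Hypothesis a_gt0 : forall k, (0 < a k.+1)%N.
Local Notation e := (@antitree_adj a).
Implicit Types (x y z u v : antitree a) (h : nat -> R).

(** Generations start at 1: generation 0 is empty, whatever [a 0] is. *)
Definition generation_size k : R := if k is 0 then 0 else (a k)%:R.

Lemma generation_size_ge0 k : 0 <= generation_size k.
Proof. by case: k => [|k] /=. Qed.

Lemma generation_size_ge1 k : 1 <= generation_size k.+1.
Proof. by rewrite /= ler1n. Qed.

Lemma adjE x z :
  e x z = (z != x) && ((gen x <= (gen z).+1) && (gen z <= (gen x).+1))%N.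
Proof. by rewrite /antitree_adj eq_sym; congr (_ && _); lia. Qed.

Lemma generation_image k : generation k.+1
  = [set Tagged (fun k => 'I_(a k.+1)) i | i in [set: 'I_(a k.+1)]]
  :> set (antitree a).
Proof.
apply/seteqP; split=> [[j i] [jk]|_ [i _ <-]//].
by subst j; exists i.
Qed.

Lemma card_generation k :
  ((generation k.+1 : set (antitree a)) #= `I_(a k.+1))%card.
Proof.
rewrite generation_image; apply: card_eq_trans (card_esym card_II).
apply: inj_card_eq => i j _ _ /eqP.
by rewrite eq_Tagged => /eqP.
Qed.

Lemma has_mass_generation k :
  has_mass (fun z => (gen z == k)%:R : R) (generation_size k).
Proof.
case: k => [|k]; first exact: eq_has_mass (has_mass0 R _).
rewrite /generation_size -(card_fset_set (card_generation k)).
apply: eq_has_mass (has_mass_set _ _); last first.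
  by exists (a k.+1); exact: card_generation.
move=> z; have [zk|zk] := eqVneq (gen z) k.+1; first by rewrite mem_set.
by rewrite memNset //; apply/eqP.
Qed.

Lemma adj_count x z k : gen x = k.+1 ->
  (e x z)%:R = (gen z == k)%:R + (gen z == k.+1)%:R + (gen z == k.+2)%:R
               - (z == x)%:R :> R.
Proof.
move=> xk; apply/eqP; rewrite eq_sym subr_eq -!natrD eqr_nat; apply/eqP.
by rewrite adjE xk; have [->|_] := eqVneq z x; rewrite ?xk; lia.
Qed.

(** The neighbours of [x] are three generations with [x] itself removed, so sums
    of functions of the generation over them are linear in the generation
    sizes. *)
Lemma has_mass_adj x k h : gen x = k.+1 -> (forall n, 0 <= h n) ->
  has_mass (fun z => h (gen z) * (e x z)%:R)
    (h k * generation_size k + h k.+1 * (generation_size k.+1 - 1)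
     + h k.+2 * generation_size k.+2).
Proof.
move=> xk h0.
rewrite (_ : _ + _ = (h k * generation_size k
  + h k.+1 * generation_size k.+1 + h k.+2 * generation_size k.+2)
                     - h k.+1 * 1); last by ring.
have hgen n :
    has_mass (fun z => h n * (gen z == n)%:R) (h n * generation_size n).
  by apply: has_massZ => //; exact: has_mass_generation.
pose F z := h k * (gen z == k)%:R + h k.+1 * (gen z == k.+1)%:R
            + h k.+2 * (gen z == k.+2)%:R.
have FB z : h (gen z) * (e x z)%:R = F z - h k.+1 * (z == x)%:R.
  rewrite (adj_count _ xk) /F !mulrDr mulrN.
  have hE n : h (gen z) * (gen z == n)%:R = h n * (gen z == n)%:R.
    by have [->|] := eqVneq (gen z) n; rewrite ?mulr0.
  rewrite !hE; congr (_ - _).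
  by have [->|] := eqVneq z x; rewrite ?xk ?mulr0.
apply: (@eq_has_mass _ _ (fun z => F z - h k.+1 * (z == x)%:R)) => [z|].
  by rewrite FB.
apply: has_massB.
- by move=> z; rewrite -subr_ge0 -FB mulr_ge0.
- by do 2?apply: has_massD.
- by apply: has_massZ => //; exact: has_mass_delta.
Qed.

(** [has_mass_adj] for the constant function 1. *)
Lemma degreeE x k : gen x = k.+1 ->
  (degree e x)%:R =
  generation_size k + (generation_size k.+1 - 1) + generation_size k.+2 :> R.
Proof.
move=> xk.
have finN : finite_set (neighbors e x).
  apply: (@sub_finite_set _ _ (\bigcup_(j in `I_k.+2) generation j.+1)).
    move=> z; rewrite /neighbors/= adjE => /andP[_ /andP[_ zx]].
    exists (gen z).-1 => //=.
    by rewrite -xk.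
  apply: bigcup_finite => // j _; exists (a j.+1); exact: card_generation.
have [_ E1] := has_mass_set R finN.
have [_ E2] := has_mass_adj (h := fun=> 1) xk (fun=> ler01).
apply: EFin_inj; rewrite -[LHS]E1 -[X in (X + _ + _)%:E]mul1r.
rewrite -[X in (_ + X + _)%:E]mul1r -[X in (_ + X)%:E]mul1r -E2.
apply: eq_esum => z _; congr (_%:E); rewrite mul1r; congr (_%:R).
have [exz|exz] := boolP (e x z); first by rewrite mem_set.
by rewrite memNset //; exact/negP.
Qed.

Lemma degree_gt0 x : 0 < (degree e x)%:R :> R.
Proof.
rewrite (@degreeE x (gen x).-1)//.
have := generation_size_ge1 (gen x).-1.
have := generation_size_ge1 (gen x).-1.+1.
by have := generation_size_ge0 (gen x).-1; lra.
Qed.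

Lemma walk_measureE x z :
  walk_measure e (0 : R) x z = (degree e x)%:R^-1 * (e x z)%:R.
Proof.
rewrite /walk_measure subr0 div1r; have [->|_] := eqVneq z x.
  by rewrite antitree_adj_irr mulr0.
by case: (e x z); rewrite ?mulr1 ?mulr0.
Qed.

Lemma has_mass_walk x k h : gen x = k.+1 -> (forall n, 0 <= h n) ->
  has_mass (fun z => h (gen z) * walk_measure e 0 x z)
    ((h k * generation_size k + h k.+1 * (generation_size k.+1 - 1)
      + h k.+2 * generation_size k.+2)
     / (degree e x)%:R).
Proof.
move=> xk h0; rewrite mulrC.
apply: (@eq_has_mass _ _ (fun z =>
  (degree e x)%:R^-1 * (h (gen z) * (e x z)%:R))).
  by move=> z; rewrite walk_measureE mulrCA.
by apply: has_massZ; rewrite ?invr_ge0//; exact: has_mass_adj.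
Qed.

(** A path that climbs one generation at each step exists because no generation
    is empty. *)
Lemma dist_gen u v : (gen u < gen v)%N ->
  (dist R e u v <= ((gen v)%:R - (gen u)%:R)%:E)%E.
Proof.
move=> uv; have [n vE] : exists n, gen v = (gen u + n.+1)%N.
  by exists (gen v - gen u).-1; lia.
suff [p [ep lp sp]] : exists p, [/\ path e u p, last u p = v & size p = n.+1].
  rewrite vE natrD addrAC subrr add0r -sp -lp; exact: dist_le_path.
elim: n u vE {uv} => [|n IHn] u vE.
  exists [:: v]; split=> //=; rewrite adjE andbT.
  by apply/andP; split; [apply/eqP => vu; move: vE; rewrite vu|]; lia.
pose w : antitree a := Tagged _ (Ordinal (a_gt0 (gen u))).
have wE : gen w = (gen u).+1 by [].
have [|p [ep lp sp]] := IHn w; first by rewrite vE wE; lia.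
exists (w :: p); split=> //=; last by rewrite sp.
rewrite ep andbT adjE; apply/andP; split; last by rewrite wE; lia.
by apply/eqP => wu; move: wE; rewrite wu; lia.
Qed.

End Antitree.

(** * Curvature of the three kinds of edges *)

Section Curvature.
Variables (R : realType) (a : nat -> nat).
Hypothesis a_gt0 : forall k, (0 < a k.+1)%N.
Local Notation e := (@antitree_adj a).
Local Notation deg x := ((degree e x)%:R : R).
Local Notation mu := (walk_measure e (0 : R)).
Implicit Types (x y z u v : antitree a).

Lemma walk_measure_mass x : has_mass (mu x) 1.
Proof.
have := has_mass_walk (erefl (gen x)) (fun=> ler01 : 0 <= 1 :> R).
rewrite !mul1r -(degreeE R (erefl (gen x))) divff ?gt_eqF ?degree_gt0//.
by apply: eq_has_mass => z; rewrite mul1r.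
Qed.

Lemma curvatureE f x y (m m' : R) :
  (forall z, 0 <= f z) -> (forall u v, e u v -> f v <= f u + 1) ->
  transportable (tight e f) (mu x) (mu y) ->
  has_mass (fun z => f z * mu x z) m -> has_mass (fun z => f z * mu y z) m' ->
  ollivier_ricci e 0 x y = (1 - (m' - m))%:E.
Proof.
move=> f0 flip fT fm fm'; rewrite /ollivier_ricci.
rewrite (wasserstein1E f0 flip _ fT fm fm')// => z.
exact: has_mass_pt (walk_measure_mass x).
Qed.

Lemma tight_refl f u : tight (R := R) e f u u.
Proof. by rewrite /tight dist_refl add0e. Qed.

Lemma tight_adj f u v : e u v -> f u + 1 <= f v -> tight (R := R) e f u v.
Proof.
move=> /(dist_adj R) duv fuv; rewrite /tight.
by apply: le_trans (leeD2r _ duv) _; rewrite -EFinD lee_fin addrC.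
Qed.

(** The potential is the indicator of [x]: the two measures differ only in that
    one charges [y] and the other charges [x], each with [1 / deg x]. *)
Lemma curvature_spherical x y : gen x = gen y -> x != y ->
  ollivier_ricci e (0 : R) x y = (1 - 1 / deg x)%:E.
Proof.
move=> xy neq_xy.
have degy : deg y = deg x.
  by rewrite (degreeE R (erefl (gen y))) (degreeE R (xy : gen x = (tag y).+1)).
have adj_xy : e x y by rewrite adjE eq_sym neq_xy xy leqnSn.
have adj_eq z : z != x -> z != y -> e x z = e y z.
  by move=> zx zy; rewrite !adjE zx zy xy.
have d_gt0 : 0 < (deg x)^-1 by rewrite invr_gt0 degree_gt0.
rewrite -[1 / deg x]subr0.
apply: (@curvatureE (fun z => (z == x)%:R)) => //.
- by move=> u v _; case: (v == x); case: (u == x) => /=; lra.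
- apply: transportable_excess (walk_measure_mass x) (walk_measure_mass y) _ _.
    exact: tight_refl.
  move=> u v; rewrite !walk_measureE degy !ltr_pM2l// => yu xv.
  have -> : u = y.
    apply: contraTeq yu => uy; have [->|ux] := eqVneq u x.
      by rewrite antitree_adj_irr -leNgt.
    by rewrite adj_eq// ltxx.
  have -> : v = x.
    apply: contraTeq xv => vx; have [->|vy] := eqVneq v y.
      by rewrite antitree_adj_irr -leNgt.
    by rewrite adj_eq// ltxx.
  apply: tight_adj; first by rewrite antitree_adj_sym.
  by rewrite eqxx eq_sym (negbTE neq_xy) add0r.
- apply: eq_has_mass (has_mass0 R _) => z; rewrite walk_measureE.
  by have [->|] := eqVneq z x; rewrite ?antitree_adj_irr ?mulr0// mul0r.
- rewrite div1r -[X in has_mass _ X]mulr1.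
  apply: eq_has_mass (has_massZ (ltW d_gt0) (has_mass_delta R x)) => z.
  rewrite walk_measureE degy.
  have [->|] := eqVneq z x; last by rewrite mulr0 mul0r.
  by rewrite antitree_adj_sym adj_xy mul1r.
Qed.

(** The potential is the distance of the generation to 2, which vanishes on the
    support of the measure of [x].  The measure of [y] exceeds that of [x] only
    in generations 1 and 3, each at distance 1 from generation 2.  The
    generation itself would not do as a potential: [x] has to be filled from
    generation 2, against the radial direction. *)
Lemma curvature_root x y : a 1%N = 1%N -> gen x = 1%N -> gen y = 2%N ->
  ollivier_ricci e (0 : R) x y = (((a 2)%:R - 1) / ((a 2)%:R + (a 3)%:R))%:E.
Proof.
move=> a1 x1 y2; pose f n : R := `|n%:R - 2|.
have dx : deg x = (a 2)%:R.
  by rewrite (degreeE R x1) /= a1 subrr addr0 add0r.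
have dy : deg y = (a 2)%:R + (a 3)%:R.
  by rewrite (degreeE R y2) /= a1 addrC [1 + _]addrC subrK addrC.
have a2 : 0 < (a 2)%:R :> R by rewrite ltr0n.
have a3 : 0 < (a 3)%:R :> R by rewrite ltr0n.
have root z : gen z = 1%N -> z = x.
  case: z x x1 {dx} => [k i] [l j] /= [lE] [kE].
  rewrite /gen/= in lE kE.
  subst k l; congr Tagged; apply/val_inj; case: i j; rewrite /= a1.
  by move=> [|//] ? [[|//] ?].
have xz z : e x z -> gen z = 2%N.
  rewrite adjE x1 => /andP[zx /andP[z1 z2]].
  have z_neq1 : gen z != 1%N by apply: contra_neq zx => /root.
  have : (0 < gen z)%N by [].
  lia.
have f0 n : 0 <= f n by rewrite /f.
have f2 : f 2%N = 0 by rewrite /f subrr normr0.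
have f1 : f 1%N = 1 by rewrite /f (_ : 1 - 2 = - 1) ?normrN1//; lra.
have f3 : f 3%N = 1 by rewrite /f (_ : 3 - 2 = 1) ?normr1//; lra.
have W : ((a 2)%:R - 1) / ((a 2)%:R + (a 3)%:R)
    = 1 - ((1 + (a 3)%:R) / deg y - 0) :> R.
  rewrite dy; move: (a 2)%:R (a 3)%:R a2 a3 => A B A_gt0 B_gt0.
  by clear -A_gt0 B_gt0; field; lra.
rewrite W; apply: (@curvatureE (fun z => f (gen z))) => [z|u v| | |].
- exact: f0.
- rewrite adjE => /andP[_ /andP[uv vu]]; rewrite /f.
  have : `|(gen v)%:R - (gen u)%:R| <= 1 :> R.
    by rewrite ler_distlC lerBlDr !natr1 !ler_nat vu uv.
  have := ler_normD ((gen v)%:R - (gen u)%:R) ((gen u)%:R - 2 : R).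
  by rewrite addrA subrK; lra.
- apply: transportable_excess (walk_measure_mass x) (walk_measure_mass y) _ _.
    by move=> ?; exact: tight_refl.
  move=> u v; rewrite !walk_measureE => xu yv.
  have {}xu : gen u = 2%N.
    apply: xz; apply: contraTT xu => /negbTE ->.
    by rewrite mulr0 -leNgt mulr_ge0 ?invr_ge0.
  have adj_yv : e y v.
    apply: contraTT yv => /negbTE ->.
    by rewrite mulr0 -leNgt mulr_ge0 ?invr_ge0.
  have v2 : gen v != 2%N.
    apply: contraTneq yv => v2; rewrite adj_yv -leNgt.
    rewrite (_ : e x v = true); last first.
      by rewrite adjE x1 v2 andbT; apply/eqP => vx; move: v2; rewrite vx x1.
    by rewrite !mulr1 lef_pV2 ?posrE ?degree_gt0// dx dy; lra.
  move: adj_yv; rewrite adjE y2 => /andP[vy /andP[v_ge v_le]].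
  have {}v2 : gen v = 1%N \/ gen v = 3%N.
    have : (0 < gen v)%N by [].
    lia.
  apply: tight_adj; last by rewrite xu f2; case: v2 => ->; rewrite ?f1 ?f3; lra.
  rewrite adjE xu; apply/andP; split; last by lia.
  by apply/eqP => vu; rewrite vu xu in v2; lia.
- apply: eq_has_mass (has_mass0 R _) => z; rewrite walk_measureE.
  by have [/xz ->|_] := boolP (e x z); rewrite ?f2 ?mul0r// !mulr0.
- have := has_mass_walk y2 (h := f) f0.
  by rewrite f1 f2 f3 /= a1 mul0r addr0 !mul1r.
Qed.

(** One minus the difference of the mean generations under the walk measures of
    the end points, which lie in generations [n + 1] and [n + 2]. *)
Lemma radial_drift (n A B C D d d' : R) :
  d = A + (B - 1) + C -> d' = B + (C - 1) + D -> 0 < d -> 0 < d' ->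
  (C - A) / d - (D - B) / d' =
  1 - (((n + 1) * B + (n + 1 + 1) * (C - 1) + (n + 1 + 1 + 1) * D) / d'
       - (n * A + (n + 1) * (B - 1) + (n + 1 + 1) * C) / d).
Proof. by move=> -> -> d0 d'0; field; lra. Qed.

(** The potential is the generation.  First [1 / deg y], the whole mass that the
    measure of [y] gives to [x], is taken from generation [k + 1], uniformly;
    afterwards the measure of [y] has an excess only in generation [k + 4],
    above everything that the measure of [x] charges. *)
Lemma curvature_radial x y k : gen x = k.+2 -> gen y = k.+3 ->
  (a k.+1 <= a k.+4)%N ->
  ollivier_ricci e (0 : R) x y =
    (((a k.+3)%:R - (a k.+1)%:R) / deg x
     - ((a k.+4)%:R - (a k.+2)%:R) / deg y)%:E.
Proof.
move=> xk yk le_a.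
have dx := degreeE R xk; have dy := degreeE R yk.
rewrite /= in dx dy.
have dx0 := degree_gt0 R a_gt0 x; have dy0 := degree_gt0 R a_gt0 y.
have le_deg : deg x <= deg y.
  by move: le_a; rewrite -(ler_nat R) dx dy; lra.
have a1 : 1 <= (a k.+1)%:R :> R by rewrite ler1n.
have a1_gt0 : 0 < (a k.+1)%:R :> R by rewrite ltr0n.
pose f (z : antitree a) : R := (gen z)%:R.
have mx := has_mass_walk xk (h := fun n => n%:R) (fun=> ler0n R _).
have my := has_mass_walk yk (h := fun n => n%:R) (fun=> ler0n R _).
rewrite (_ : _ - _ = 1 - ((k.+2%:R * (a k.+2)%:R + k.+3%:R * ((a k.+3)%:R - 1)
    + k.+4%:R * (a k.+4)%:R) / deg y - (k.+1%:R * (a k.+1)%:R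
    + k.+2%:R * ((a k.+2)%:R - 1) + k.+3%:R * (a k.+3)%:R) / deg x));
  last first.
  rewrite -![_.+4%:R]natr1 -![_.+3%:R]natr1 -![_.+2%:R]natr1.
  exact: radial_drift.
apply: (@curvatureE f) => // [u v|].
  by rewrite adjE /f natr1 ler_nat => /andP[_ /andP[]].
have tight_gen u v : (gen u < gen v)%N -> tight (R := R) e f u v.
  move=> uv; rewrite /tight.
  apply: le_trans (leeD2r _ (dist_gen R a_gt0 uv)) _.
  by rewrite -EFinD lee_fin subrK.
(* [c] is the uniform share of each vertex of generation [k + 1]; it does not
   exceed what the measure of [x] has there, since [deg x <= deg y]. *)
pose c := (deg y)^-1 / (a k.+1)%:R.
have c_ge0 : 0 <= c by rewrite divr_ge0// invr_ge0 ltW.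
have Bx_mass : has_mass (fun z => c * (gen z == k.+1)%:R) (deg y)^-1.
  have -> : (deg y)^-1 = c * generation_size R a k.+1.
    by rewrite /c/= divfK// gt_eqF.
  by apply: has_massZ => //; exact: has_mass_generation.
have By_mass : has_mass (fun z => (deg y)^-1 * (z == x)%:R) (deg y)^-1.
  rewrite -[X in has_mass _ X]mulr1.
  apply: has_massZ; last exact: has_mass_delta.
  by rewrite invr_ge0 ltW.
have le_inv : (deg y)^-1 <= (deg x)^-1 by rewrite lef_pV2.
have Bx_le z : c * (gen z == k.+1)%:R <= mu x z.
  rewrite walk_measureE; have [zk|] := eqVneq (gen z) k.+1; last first.
    by rewrite mulr0 mulr_ge0// invr_ge0 ltW.
  rewrite (_ : e x z = true).
    rewrite !mulr1; apply: le_trans le_inv.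
    by rewrite ler_pdivrMr// ler_peMr// invr_ge0 ltW.
  rewrite adjE xk zk; apply/andP; split; last by lia.
  by apply/eqP => zx; move: zk; rewrite zx xk; lia.
have By_le z : (deg y)^-1 * (z == x)%:R <= mu y z.
  rewrite walk_measureE ler_pM2l ?invr_gt0// ler_nat.
  have [->|//] := eqVneq z x.
  rewrite (_ : e y x = true)// adjE xk yk; apply/andP; split; last by lia.
  by apply/eqP => xy; move: yk; rewrite -xy xk; lia.
rewrite (_ : mu x = fun z => c * (gen z == k.+1)%:R
  + (mu x z - c * (gen z == k.+1)%:R)); last first.
  by apply/funext => z; rewrite addrC subrK.
rewrite (_ : mu y = fun z => (deg y)^-1 * (z == x)%:R
  + (mu y z - (deg y)^-1 * (z == x)%:R)); last first.
  by apply/funext => z; rewrite addrC subrK.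
apply: transportableD.
  apply: transportable_prod Bx_mass By_mass _ => u v.
  have [uk|_] := eqVneq (gen u) k.+1; last by rewrite mulr0 eqxx.
  have [->|_] := eqVneq v x; last by rewrite mulr0 eqxx.
  by move=> _ _; apply: tight_gen; rewrite uk xk.
apply: transportable_excess.
- exact: has_massB Bx_le (walk_measure_mass x) Bx_mass.
- exact: has_massB By_le (walk_measure_mass y) By_mass.
- exact: tight_refl.
move=> u v exc_u exc_v; apply: tight_gen.
have adj_xu : e x u.
  apply: contraTT exc_u => /negbTE xu.
  rewrite -leNgt; apply: (@le_trans _ _ 0); last by rewrite subr_ge0 By_le.
  by rewrite walk_measureE xu mulr0 subr_le0 mulr_ge0.
have adj_yv : e y v.
  apply: contraTT exc_v => /negbTE yv.
  rewrite -leNgt; apply: (@le_trans _ _ 0); last by rewrite subr_ge0 Bx_le.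
  by rewrite walk_measureE yv mulr0 subr_le0 mulr_ge0// invr_ge0 ltW.
have v_neq_x : v != x.
  apply: contraTneq exc_v => ->; rewrite -leNgt.
  apply: (@le_trans _ _ 0); last by rewrite subr_ge0 Bx_le.
  rewrite subr_le0 eqxx walk_measureE; apply: ler_wpM2l.
    by rewrite invr_ge0 ltW.
  by case: (e y x).
(* In generations [k + 2] and [k + 3], away from [x] and [y], both measures are
   uniform and that of [x] is at least as large. *)
suff vk : gen v = k.+4 by move: adj_xu; rewrite adjE xk vk; lia.
apply: contraTeq exc_v => vk; rewrite -leNgt.
move: (adj_yv); rewrite adjE yk => /andP[_ /andP[v_ge v_le]].
rewrite (negbTE v_neq_x) mulr0 subr0 (_ : (gen v == k.+1) = false); last by lia.
rewrite mulr0 subr0 !walk_measureE adj_yv (_ : e x v = true) ?mulr1//.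
by rewrite adjE v_neq_x xk; lia.
Qed.

End Curvature.

(** * Generations of geometric size *)

Section Geometric.
Variable (R : realType).
Implicit Types (q Q : R).

(** The drift formula for [Q = q ^ (k - 2)]; [q, Q >= 1] keeps the degrees
    positive. *)
Lemma geometric_radial q Q : 1 <= q -> 1 <= Q ->
  (q ^+ 2 * Q - Q) / (Q + (q * Q - 1) + q ^+ 2 * Q)
  - (q ^+ 3 * Q - q * Q) / (q * Q + (q ^+ 2 * Q - 1) + q ^+ 3 * Q)
  = ((q - 1) ^+ 2 * (q + 1) * Q)
    / ((q ^+ 2 * Q + q * Q + Q - 1) * (q ^+ 3 * Q + q ^+ 2 * Q + q * Q - 1)).
Proof.
move=> q1 Q1.
have qQ : 1 <= q * Q by rewrite mulr_ege1.
have q2Q : 1 <= q ^+ 2 * Q by rewrite mulr_ege1// exprn_ege1.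
have q3Q : 1 <= q ^+ 3 * Q by rewrite mulr_ege1// exprn_ege1.
field; do ?[apply/andP; split]; rewrite ?gt_eqF//; lra.
Qed.

(** With [t = q ^ (-k)], the degrees are
    [q ^ (k - 2) * (q^2 + q + 1 - q^2 t)] and
    [q ^ (k - 1) * (q^2 + q + 1 - q t)], and the powers of [q] cancel up to one
    factor [q]. *)
Lemma geometric_radial_rescaled q k : 1 < q -> (2 <= k)%N ->
  q ^+ k * (((q - 1) ^+ 2 * (q + 1) * q ^+ (k - 2)) /
           ((q ^+ k + q ^+ (k - 1) + q ^+ (k - 2) - 1) *
            (q ^+ (k + 1) + q ^+ k + q ^+ (k - 1) - 1)))
  = (q - 1) ^+ 2 * (q + 1) * q
    * ((q ^+ 2 + q + 1 - q ^+ 2 * q^-1 ^+ k)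
       * (q ^+ 2 + q + 1 - q * q^-1 ^+ k))^-1.
Proof.
move=> q1; case: k => [|[|k]]// _; have q0 : 0 < q by lra.
rewrite !subSS !subn0 addn1 exprVn -[k.+3]/(3 + k)%N -[k.+2]/(2 + k)%N.
rewrite -[k.+1]/(1 + k)%N !exprD expr1.
have : 1 <= q ^+ k by rewrite exprn_ege1 ?ltW.
move: (q ^+ k) => Q Q1.
have Q0 : 0 < Q by lra.
have qQ : 1 <= q * Q by rewrite mulr_ege1// ltW.
have q2Q : 1 <= q ^+ 2 * Q by rewrite mulr_ege1// exprn_ege1// ltW.
have q3Q : 1 <= q ^+ 3 * Q by rewrite mulr_ege1// exprn_ege1// ltW.
field.
do ?[apply/andP; split]; rewrite ?gt_eqF//; lra.
Qed.

Lemma geometric_radial_limit q : 1 <= q ->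
  q ^+ k * (((q - 1) ^+ 2 * (q + 1) * q ^+ (k - 2)) /
           ((q ^+ k + q ^+ (k - 1) + q ^+ (k - 2) - 1) *
            (q ^+ (k + 1) + q ^+ k + q ^+ (k - 1) - 1))) @[k --> \oo]
  --> (q - 1) ^+ 2 * (q + 1) * q / (q ^+ 2 + q + 1) ^+ 2.
Proof.
(* For [q = 1] the powers [q ^ (-k)] do not tend to 0, but all terms vanish. *)
rewrite le_eqVlt => /orP[/eqP<-|q1].
  rewrite subrr expr0n/= !mul0r.
  under eq_fun do rewrite !(mul0r, mulr0).
  exact: cvg_cst.
pose t k : R := q^-1 ^+ k.
have q0 : 0 < q by lra.
have t0 : t @ \oo --> 0.
  apply: cvg_expr; rewrite ger0_norm ?invr_ge0 ?ltW// invf_lt1//.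
have lin c : (q ^+ 2 + q + 1 - c * t k) @[k --> \oo] --> q ^+ 2 + q + 1.
  rewrite -[X in _ --> X]subr0 -[X in _ - X](mulr0 c).
  by apply: cvgB; [exact: cvg_cst|apply: cvgMr].
have qq : q ^+ 2 + q + 1 != 0.
  by rewrite gt_eqF//; have := exprn_gt0 2 q0; lra.
have lim : ((q - 1) ^+ 2 * (q + 1) * q
    * ((q ^+ 2 + q + 1 - q ^+ 2 * t k) * (q ^+ 2 + q + 1 - q * t k))^-1)
    @[k --> \oo] --> (q - 1) ^+ 2 * (q + 1) * q / (q ^+ 2 + q + 1) ^+ 2.
  apply: cvgMr; apply: cvgV; first by rewrite expf_neq0.
  by rewrite expr2; apply: cvgM.
apply: cvg_trans lim; apply: near_eq_cvg; near=> k.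
have k2 : (2 <= k)%N by near: k; exact: nbhs_infty_ge.
by rewrite -geometric_radial_rescaled.
Unshelve. all: by end_near.
Qed.

End Geometric.

Theorem corollary1p8 (R : realType) (r : nat) (r_gt0 : (0 < r)%N) :
  let a := fun k : nat => (r ^ (k - 1))%N in
  let V := generation (a := a) in
  let kappa0 := ollivier_ricci (@antitree_adj a) (0 : R) in
  let q : R := r%:R in
  [/\ forall x y : antitree a, V 1%N x -> V 2%N y ->
        kappa0 x y = ((q - 1) / (q * (q + 1)))%:E,
      forall (k : nat) (x y : antitree a), (2 <= k)%N -> V k x -> V k.+1 y ->
        kappa0 x y =
          (((q - 1) ^+ 2 * (q + 1) * q ^+ (k - 2)) /
           ((q ^+ k + q ^+ (k - 1) + q ^+ (k - 2) - 1) *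
            (q ^+ (k + 1) + q ^+ k + q ^+ (k - 1) - 1)))%:E,
      forall (k : nat) (x y : antitree a), (2 <= k)%N -> V k x -> V k y ->
        x <> y ->
        kappa0 x y = (1 - 1 / (q ^+ k + q ^+ (k - 1) + q ^+ (k - 2) - 1))%:E
    & exists C : R, ((1 < r)%N -> 0 < C) /\
        forall x y : nat -> antitree a,
          (forall k : nat, (1 <= k)%N -> V k (x k) /\ V k.+1 (y k)) ->
          ((q ^+ k)%:E * kappa0 (x k) (y k))%E @[k --> \oo] --> C%:E].
Proof.
move=> a V kappa0 q.
have a_gt0 k : (0 < a k.+1)%N by rewrite /a expn_gt0 r_gt0.
have aE k : (a k.+1)%:R = q ^+ k :> R by rewrite /a subn1 natrX.
have q1 : 1 <= q by rewrite ler1n.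
have degE k (x : antitree a) : V k.+2 x ->
    (degree (@antitree_adj a) x)%:R = q ^+ k + (q ^+ k.+1 - 1) + q ^+ k.+2 :> R.
  by move=> xk; rewrite (degreeE R (xk : gen x = k.+2)) /= !aE.
have radial k x y : (2 <= k)%N -> V k x -> V k.+1 y -> kappa0 x y =
    (((q - 1) ^+ 2 * (q + 1) * q ^+ (k - 2)) /
     ((q ^+ k + q ^+ (k - 1) + q ^+ (k - 2) - 1) *
      (q ^+ (k + 1) + q ^+ k + q ^+ (k - 1) - 1)))%:E.
  case: k => [|[|k]]// _ xk yk.
  rewrite /kappa0 (curvature_radial R a_gt0 xk yk); last first.
    by rewrite /a leq_pexp2l//; lia.
  rewrite (degE _ _ xk) (degE _ _ yk) !aE; congr (_%:E).
  rewrite !subSS !subn0 addn1 ?subn1/= -[k.+3]/(3 + k)%N -[k.+2]/(2 + k)%N.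
  rewrite -[k.+1]/(1 + k)%N !exprD expr1.
  by apply: geometric_radial => //; exact: exprn_ege1.
split=> //.
- move=> x y x1 y2; rewrite /kappa0 (curvature_root R a_gt0 _ x1 y2)//.
  by rewrite !aE; congr (_ / _)%:E; rewrite expr1 expr2; ring.
- move=> k x y; case: k => [|[|k]]// _ xk yk /eqP neq_xy.
  rewrite /kappa0 (curvature_spherical R a_gt0 _ neq_xy); last first.
    by rewrite (xk : gen x = _) (yk : gen y = _).
  rewrite (degE _ _ xk) !subSS !subn0; congr (1 - 1 / _)%:E.
  by ring.
exists ((q - 1) ^+ 2 * (q + 1) * q / (q ^+ 2 + q + 1) ^+ 2); split.
  move=> r1; have {}q1 : 1 < q by rewrite ltr1n.
  have q0 : 0 < q by exact: lt_trans q1.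
  have q_sub1 : 0 < q - 1 by rewrite subr_gt0.
  have q_add1 : 0 < q + 1 by rewrite addr_gt0.
  apply: divr_gt0; first by rewrite 2?mulr_gt0// exprn_gt0.
  by apply: exprn_gt0; rewrite -addrA addr_gt0// exprn_gt0.
move=> x y xy; apply: (@cvg_trans _ ((q ^+ k *
    (((q - 1) ^+ 2 * (q + 1) * q ^+ (k - 2)) /
     ((q ^+ k + q ^+ (k - 1) + q ^+ (k - 2) - 1) *
      (q ^+ (k + 1) + q ^+ k + q ^+ (k - 1) - 1))))%:E @[k --> \oo])).
  apply: near_eq_cvg; near=> k.
  have k2 : (2 <= k)%N by near: k; exact: nbhs_infty_ge.
  have [xk yk] := xy k (ltnW k2).
  by rewrite (radial k)// -EFinM.
by apply: cvg_EFin; [exact: nearW|exact: geometric_radial_limit].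
Unshelve. all: by end_near.
Qed.
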